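(* Let $\Phi=\{\varphi_n\}_{n=1}^N\subseteq\mathbb{R}^M$ and let $\sqrt{\mathcal{A}}\colon\mathbb{R}^M/\{\pm1\}\rightarrow\mathbb{R}^N$ be defined by $(\sqrt{\mathcal{A}}(x))(n):=|\langle x,\varphi_n\rangle|$. Let $\alpha$ be the lower Lipschitz constant for $\sqrt{\mathcal{A}}$, i.e., the largest constant such that $\alpha\operatorname{d}(x,y)\leq\|\sqrt{\mathcal{A}}(x)-\sqrt{\mathcal{A}}(y)\|$ for all $x,y\in\mathbb{R}^M/\{\pm1\}$. Then $$\sigma\leq\alpha\leq\sqrt{2}\,\sigma,$$ where $\sigma$ is the largest scalar for which $\Phi$ has the $\sigma$-strong complement property.
   Context: $\mathbb{R}^M/\{\pm1\}$ denotes $\mathbb{R}^M$ with $x$ and $-x$ identified, equipped with the metric $\operatorname{d}(x,y):=\min\{\|x-y\|,\|x+y\|\}$, where $\|\cdot\|$ is the Euclidean norm. $\Phi$ is also regarded as the $M\times N$ matrix whose $n$th column is $\varphi_n$, and for $S\subseteq\{1,\ldots,N\}$, $\Phi_S$ is the submatrix of columns indexed by $S$. An $M\times N$ matrix $\Phi$ satisfies the $\sigma$-strong complement property ($\sigma$-SCP) if $\max\{\lambda_{\min}(\Phi_S\Phi_S^* ),\lambda_{\min}(\Phi_{S^{\mathrm{c}}}\Phi_{S^{\mathrm{c}}}^* )\}\geq\sigma^2$ for every $S\subseteq\{1,\ldots,N\}$, where $\lambda_{\min}$ denotes the smallest eigenvalue of the given $M\times M$ matrix (with $\Phi_S\Phi_S^*=0$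 when $S=\emptyset$). *)

(* Defs.v *)
From HB Require Import structures.
From mathcomp Require Import all_boot all_order all_algebra.
From mathcomp Require Import generic_quotient.
From mathcomp Require Import classical_sets reals.

Set Implicit Arguments.
Unset Strict Implicit.
Unset Printing Implicit Defensive.

Import Order.TTheory GRing.Theory Num.Theory.
Local Open Scope ring_scope.
Local Open Scope classical_set_scope.
Local Open Scope quotient_scope.

Section Euclidean.
Variables (R : realType) (n : nat).
Implicit Types x y : 'cV[R]_n.

Definition inner x y : R := \sum_i x i 0 * y i 0.

(* The library's norm [`|x|] on matrices is the sup norm. *)
Definition enorm x : R := Num.sqrt (inner x x).

Lemma innerNl x y : inner (- x) y = - inner x y.
Proof. by rewrite /inner -sumrN; apply: eq_bigr => i _; rewrite mxE mulNr. Qed.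

Lemma innerNr x y : inner x (- y) = - inner x y.
Proof. by rewrite /inner -sumrN; apply: eq_bigr => i _; rewrite mxE mulrN. Qed.

Lemma enormN x : enorm (- x) = enorm x.
Proof. by rewrite /enorm innerNl innerNr opprK. Qed.

End Euclidean.

Section SignQuotient.
Variables (R : realType) (M : nat).
Implicit Types x y : 'cV[R]_M.

Definition sign_eq x y : bool := (x == y) || (x == - y).

Lemma sign_eq_refl : reflexive sign_eq.
Proof. by move=> x; rewrite /sign_eq eqxx. Qed.

Lemma sign_eq_sym : symmetric sign_eq.
Proof.
by move=> x y; rewrite /sign_eq [y == x]eq_sym [y == - x]eq_sym eqr_oppLR.
Qed.

Lemma sign_eq_trans : transitive sign_eq.
Proof.
move=> y x z /orP[] /eqP-> // /orP[] /eqP->; rewrite /sign_eq ?opprK eqxx //.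
by rewrite orbT.
Qed.

Canonical sign_equiv := EquivRel sign_eq sign_eq_refl sign_eq_sym sign_eq_trans.

(* R^M / {+1, -1} *)
Definition sign_quot := {eq_quot sign_equiv}.

HB.instance Definition _ := Choice.on sign_quot.
HB.instance Definition _ := EqQuotient.on sign_quot.

Definition sign_dist (p q : sign_quot) : R :=
  Num.min (enorm (repr p - repr q)) (enorm (repr p + repr q)).

Lemma repr_sign_pi x :
  repr (\pi_sign_quot x) = x \/ repr (\pi_sign_quot x) = - x.
Proof.
have /eqmodP/orP : repr (\pi_sign_quot x) = x %[mod sign_quot] by rewrite reprK.
by case=> /eqP->; [left | right].
Qed.

Lemma sign_dist_pi x y :
  sign_dist (\pi x) (\pi y) = Num.min (enorm (x - y)) (enorm (x + y)).
Proof.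
rewrite /sign_dist; case: (repr_sign_pi x) => ->;
  case: (repr_sign_pi y) => -> //.
- by rewrite opprK minC.
- by rewrite -opprD enormN -[- x + y]opprK enormN opprD !opprK minC.
- by rewrite -!opprD !enormN.
Qed.

End SignQuotient.

Section Frame.
Variables (R : realType) (M N : nat).
Implicit Types (Phi : 'M[R]_(M, N)) (S : {set 'I_N}).

Definition sqrtA Phi (p : sign_quot R M) : 'cV[R]_N :=
  \col_n `|inner (repr p) (col n Phi)|.

Lemma sqrtA_pi Phi (x : 'cV[R]_M) :
  sqrtA Phi (\pi x) = \col_n `|inner x (col n Phi)|.
Proof.
apply/colP => n; rewrite !mxE.
by case: (repr_sign_pi x) => ->; rewrite ?innerNl ?normrN.
Qed.

Definition lower_lipschitz_bound Phi (a : R) : Prop :=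
  forall p q : sign_quot R M,
    a * sign_dist p q <= enorm (sqrtA Phi p - sqrtA Phi q).

Definition subcols Phi S : 'M[R]_(M, #|S|) :=
  colsub (fun j : 'I_#|S| => enum_val j) Phi.

(* A matrix has finitely many eigenvalues, so for a real symmetric matrix of
   positive size the infimum is attained: it is the smallest eigenvalue. *)
Definition lambda_min (A : 'M[R]_M) : R := inf [set a | eigenvalue A a].

Definition gram Phi S : 'M[R]_M := subcols Phi S *m (subcols Phi S)^T.

Definition strong_complement_property Phi (s : R) : Prop :=
  forall S : {set 'I_N},
    s ^+ 2 <= Num.max (lambda_min (gram Phi S)) (lambda_min (gram Phi (~: S))).

End Frame.

Definition is_largest (R : realType) (P : R -> Prop) (a : R) : Prop :=
  P a /\ forall b, P b -> b <= a.

(* Both largest constants exist, the Lipschitz one when M > 0; for M = 0 the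
   quotient is a single point and every real number is a lower bound. *)
Section Existence.
Variables (R : realType) (M N : nat) (Phi : 'M[R]_(M, N)).

Lemma inner_ge0 n (x : 'cV[R]_n) : 0 <= inner x x.
Proof. by apply: sumr_ge0 => i _; exact: sqr_ge0. Qed.

Lemma inner_gt0 n (x : 'cV[R]_n) : x != 0 -> 0 < inner x x.
Proof.
move=> x0; rewrite lt_neqAle inner_ge0 andbT eq_sym.
apply: contra x0; rewrite psumr_eq0 => [/allP x0 | i _]; last exact: sqr_ge0.
apply/eqP/colP => i; rewrite mxE; apply/eqP.
by have := x0 i (mem_index_enum i); rewrite mulf_eq0 orbb.
Qed.

Lemma lambda_min_gram_ge0 (S : {set 'I_N}) : 0 <= lambda_min (gram Phi S).
Proof.
rewrite /lambda_min; set E := [set _ | _].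
have [-> | En0] := eqVneq E set0; first by rewrite inf0.
apply: lb_le_inf; first exact/set0P.
move=> a /= /eigenvalueP[v vG v0].
have innerE n (w : 'rV[R]_n) : (w *m w^T) 0 0 = inner w^T w^T.
  by rewrite mxE; apply: eq_bigr => i _; rewrite !mxE.
have vT0 : v^T != 0 by rewrite -(inj_eq trmx_inj) trmxK trmx0.
rewrite -(pmulr_lge0 _ (inner_gt0 vT0)) -innerE.
have -> : a * (v *m v^T) 0 0
    = ((v *m subcols Phi S) *m (v *m subcols Phi S)^T) 0 0.
  by rewrite trmx_mul mulmxA -[v *m _ *m _]mulmxA vG -scalemxAl [RHS]mxE.
by rewrite innerE inner_ge0.
Qed.

Lemma strong_complement_largest :
  exists s, is_largest (strong_complement_property Phi) s.
Proof.
pose F (S : {set 'I_N}) :=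
  Num.max (lambda_min (gram Phi S)) (lambda_min (gram Phi (~: S))).
case: (@Order.TotalTheory.arg_minP _ _ _ (finset.set0 : {set 'I_N}) xpredT F isT) => S _ FS.
have FS0 : 0 <= F S by rewrite le_max lambda_min_gram_ge0.
exists (Num.sqrt (F S)); split=> [T | b /(_ S) bS].
  by rewrite sqr_sqrtr //; exact: FS.
by rewrite (le_trans (ler_norm b)) // -sqrtr_sqr ler_wsqrtr.
Qed.

Lemma lower_lipschitz_largest :
  (0 < M)%N -> exists a, is_largest (lower_lipschitz_bound Phi) a.
Proof.
move=> M0.
have dist_ge0 (p q : sign_quot R M) : 0 <= sign_dist p q.
  by rewrite le_min !sqrtr_ge0.
pose E := [set a | lower_lipschitz_bound Phi a].
have E0 : E !=set0 by exists 0 => p q; rewrite mul0r sqrtr_ge0.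
pose e : 'cV[R]_M := delta_mx (Ordinal M0) 0.
have e0 : e != 0.
  by apply/eqP => /colP/(_ (Ordinal M0)) /eqP; rewrite !mxE !eqxx oner_eq0.
pose p0 : sign_quot R M := \pi e; pose q0 : sign_quot R M := \pi 0.
have d0 : 0 < sign_dist p0 q0.
  by rewrite sign_dist_pi subr0 addr0 minxx sqrtr_gt0 inner_gt0.
have ubE p q : 0 < sign_dist p q ->
    ubound E (enorm (sqrtA Phi p - sqrtA Phi q) / sign_dist p q).
  by move=> d a /(_ p q); rewrite ler_pdivlMr.
exists (sup E); split=> [p q | b Eb].
  have := dist_ge0 p q; rewrite le_eqVlt => /orP[/eqP<- | d].
    by rewrite mulr0 sqrtr_ge0.
  by rewrite -ler_pdivlMr //; apply: ge_sup => //; exact: ubE.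
by apply: ub_le_sup => //; eexists; apply: ubE d0.
Qed.

End Existence.

(* Main.v *)
(** The smallest eigenvalue of a symmetric matrix A is the largest m such that
    A - m is positive semidefinite: A - m is then singular, because an
    invertible positive semidefinite matrix is coercive.

    For the lower bound, let S be the set of n where <x, phi_n> and <y, phi_n>
    have the same sign.  The squared distance of the images of x and y is then
    the Gram form of S at x - y plus the Gram form of its complement at x + y.
    For the upper bound, take S minimizing the maximum in the strong complement
    property, unit eigenvectors u and v for the smallest eigenvalues of the
    Gram matrices of S and of its complement, and test the Lipschitz bound on
    x = u + v and y = u - v, whose distance is 2. *)
Require Import Defs.
From mathcomp Require Import all_boot all_order all_algebra.
From mathcomp Require Import reals.
From mathcomp Require Import generic_quotient classical_sets lra.

Set Implicit Arguments.
Unset Strict Implicit.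

Import Order.TTheory GRing.Theory Num.Theory.
Local Open Scope ring_scope.

(** * Inner products, quadratic forms and coercivity *)

Section InnerProduct.
Variables (R : realType) (n : nat).
Implicit Types (x y z : 'cV[R]_n) (A : 'M[R]_n).

Lemma innerC x y : inner x y = inner y x.
Proof. by apply: eq_bigr => i _; rewrite mulrC. Qed.

Lemma innerDl x y z : inner (x + y) z = inner x z + inner y z.
Proof. by rewrite -big_split; apply: eq_bigr => i _; rewrite mxE mulrDl. Qed.

Lemma innerDr x y z : inner x (y + z) = inner x y + inner x z.
Proof. by rewrite innerC innerDl !(innerC x). Qed.

Lemma innerZl a x y : inner (a *: x) y = a * inner x y.
Proof. by rewrite mulr_sumr; apply: eq_bigr => i _; rewrite mxE mulrA. Qed.

Lemma innerZr a x y : inner x (a *: y) = a * inner x y.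
Proof. by rewrite innerC innerZl innerC. Qed.

Lemma inner_mulmx m (B : 'M[R]_(n, m)) x (y : 'cV[R]_m) :
  inner x (B *m y) = inner (B^T *m x) y.
Proof.
have innerE k (u w : 'cV[R]_k) : inner u w = (u^T *m w) 0 0.
  by rewrite mxE; apply: eq_bigr => i _; rewrite mxE.
by rewrite !innerE trmx_mul trmxK mulmxA.
Qed.

Lemma sqr_enorm x : enorm x ^+ 2 = inner x x.
Proof. by rewrite sqr_sqrtr // inner_ge0. Qed.

Lemma enormZ a x : enorm (a *: x) = `|a| * enorm x.
Proof.
by rewrite /enorm innerZl innerZr mulrA -expr2 sqrtrM ?sqr_ge0 // sqrtr_sqr.
Qed.

Lemma quad_form_le A :
  exists2 K : R, 0 < K & forall x, `|inner x (A *m x)| <= K * inner x x.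
Proof.
(* The summand 1 keeps the constant positive even for [A = 0], so that it can be inverted. *)
exists (1 + \sum_i \sum_j `|A i j|).
  by rewrite ltr_pwDl // sumr_ge0 // => i _; rewrite sumr_ge0.
move=> x; rewrite mulrDl mul1r.
have xi_le i : `|x i 0| ^+ 2 <= inner x x.
  rewrite real_normK ?num_real // /inner (bigD1 i) //= -expr2 lerDl.
  by rewrite sumr_ge0 // => j _; exact: sqr_ge0.
have xij_le i j : `|x i 0 * x j 0| <= inner x x.
  by rewrite normrM; have := xi_le i; have := xi_le j; nra.
suff qE : `|inner x (A *m x)| <= (\sum_i \sum_j `|A i j|) * inner x x.
  by have := inner_ge0 x; lra.
rewrite mulr_suml (le_trans (ler_norm_sum _ _ _)) // ler_sum // => i _.
rewrite mulr_suml mxE mulr_sumr (le_trans (ler_norm_sum _ _ _)) //.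
rewrite ler_sum // => j _.
by rewrite mulrCA normrM ler_wpM2l.
Qed.

Lemma psd_unitmx_coercive A :
    A^T = A -> (forall x, 0 <= inner x (A *m x)) -> A \in unitmx ->
  exists2 c : R, 0 < c & forall x, c * inner x x <= inner x (A *m x).
Proof.
move=> symA psdA unitA; have [K K0 boundK] := quad_form_le (invmx A).
exists K^-1 => [|x]; first by rewrite invr_gt0.
(* The form is nonnegative at x - t A^-1 x; take t = 1 / K. *)
set y := invmx A *m x.
have Ay : A *m y = x by rewrite mulmxA mulmxV // mul1mx.
have := psdA (x - K^-1 *: y).
rewrite mulmxDr mulmxN -scalemxAr Ay.
rewrite !(innerDl, innerDr, innerNl, innerNr, innerZl, innerZr).
rewrite (inner_mulmx A y) symA Ay (innerC y).
have := le_trans (ler_norm _) (boundK x); rewrite -/y => xy_le.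
(* The cross terms contribute [- 2 t * inner x x]; for t = 1 / K the quadratic term gives back at
   most half of it. *)
have : K^-1 * (K^-1 * inner x y) <= K^-1 * inner x x.
  by apply: ler_wpM2l; rewrite ?ler_pdivrMl // invr_ge0 ltW.
lra.
Qed.

(** [eigenvalue] concerns row vectors; symmetry lets a row eigenvector be transposed and then
    normalized. *)
Lemma eigenvalue_sym A a :
  A^T = A -> eigenvalue A a ->
  exists2 x : 'cV[R]_n, inner x x = 1 & A *m x = a *: x.
Proof.
move=> symA /eigenvalueP[v vA v0].
have vT0 : v^T != 0 by rewrite -trmx0 (inj_eq trmx_inj).
have e0 : enorm v^T != 0 by rewrite gt_eqF // sqrtr_gt0 inner_gt0.
exists ((enorm v^T)^-1 *: v^T).
  by rewrite innerZl innerZr -sqr_enorm expr2 mulKf // mulVf.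
rewrite -scalemxAr -{1}symA -trmx_mul vA.
by rewrite linearZ /= !scalerA mulrC.
Qed.

End InnerProduct.

(** * Variational description of the smallest eigenvalue *)

Section SmallestEigenvalue.
Variables (R : realType) (n : nat) (A : 'M[R]_n).
Hypotheses (n_gt0 : (0 < n)%N) (symA : A^T = A).
Local Open Scope classical_set_scope.

(** These are the c for which A - c is positive semidefinite. *)
Let E : set R :=
  [set c | forall x : 'cV[R]_n, c * inner x x <= inner x (A *m x)].
Let m := sup E.

Let E_neq0 : E !=set0.
Proof.
have [K _ boundK] := quad_form_le A.
by exists (- K) => x; move: (boundK x); rewrite ler_norml mulNr => /andP[].
Qed.

Let E_bounded : has_ubound E.
Proof.
pose e : 'cV[R]_n := delta_mx (Ordinal n_gt0) 0.
have e0 : e != 0.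
  by apply/eqP => /colP/(_ (Ordinal n_gt0)) /eqP; rewrite !mxE !eqxx oner_eq0.
exists (inner e (A *m e) / inner e e) => c /(_ e).
by rewrite ler_pdivlMr ?inner_gt0.
Qed.

Let supE : E m.
Proof.
move=> x; have [->|x0] := eqVneq x 0.
  by rewrite -(scale0r 0) !innerZl !mul0r mulr0.
rewrite -ler_pdivlMr ?inner_gt0 //; apply: ge_sup => // c /(_ x).
by rewrite ler_pdivlMr ?inner_gt0.
Qed.

Let form_sub x : inner x ((A - m%:M) *m x) = inner x (A *m x) - m * inner x x.
Proof. by rewrite mulmxBl mul_scalar_mx innerDr innerNr innerZr. Qed.

(** Otherwise A - m is coercive with some constant c > 0, and m + c lies in [E] above its
    supremum. *)
Let eigenvalue_sup : eigenvalue A m.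
Proof.
rewrite /eigenvalue /eigenspace kermx_eq0 row_free_unit; apply/negP => unitB.
have symB : (A - m%:M)^T = A - m%:M by rewrite linearB /= symA tr_scalar_mx.
have psdB x : 0 <= inner x ((A - m%:M) *m x).
  by rewrite form_sub subr_ge0; exact: supE.
have [c c0 cE] := psd_unitmx_coercive symB psdB unitB.
suff mcE : E (m + c).
  by have := ub_le_sup E_bounded mcE; rewrite -/m gerDl leNgt c0.
by move=> x; have := cE x; rewrite form_sub; lra.
Qed.

Let lambda_minE : lambda_min A = m.
Proof.
have m_le a : eigenvalue A a -> m <= a.
  move=> /(eigenvalue_sym symA)[x x1 Ax].
  by have := supE x; rewrite Ax innerZr x1 !mulr1.
apply/eqP; rewrite eq_le; apply/andP; split.
  by apply: ge_inf; [exists m => a /m_le | exact: eigenvalue_sup].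
by apply: lb_le_inf => [|a /m_le //]; exists m; exact: eigenvalue_sup.
Qed.

Lemma lambda_min_form x : lambda_min A * inner x x <= inner x (A *m x).
Proof. by rewrite lambda_minE; exact: supE. Qed.

Lemma lambda_min_attained :
  exists2 x : 'cV[R]_n, inner x x = 1 & inner x (A *m x) = lambda_min A.
Proof.
have [x x1 Ax] := eigenvalue_sym symA eigenvalue_sup.
by exists x => //; rewrite Ax innerZr x1 mulr1 lambda_minE.
Qed.

End SmallestEigenvalue.

(** * The two Lipschitz estimates *)

Section Frame.
Variables (R : realType) (M N : nat) (Phi : 'M[R]_(M, N)).
Implicit Types (S : {set 'I_N}) (x y : 'cV[R]_M).

Lemma gram_sym S : (gram Phi S)^T = gram Phi S.
Proof. by rewrite /gram trmx_mul trmxK. Qed.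

Lemma gram_form S x :
  inner x (gram Phi S *m x) = \sum_(n in S) inner x (col n Phi) ^+ 2.
Proof.
rewrite /gram -mulmxA inner_mulmx big_enum_val; apply: eq_bigr => j _.
rewrite expr2; suff -> : ((subcols Phi S)^T *m x) j 0
    = inner x (col (enum_val j) Phi) by [].
by rewrite mxE; apply: eq_bigr => i _; rewrite !mxE mulrC.
Qed.

Lemma inner_sqrtA_sub S x y :
  inner (sqrtA Phi (\pi x)%qT - sqrtA Phi (\pi y)%qT)
        (sqrtA Phi (\pi x)%qT - sqrtA Phi (\pi y)%qT) =
  \sum_(n in S) (`|inner x (col n Phi)| - `|inner y (col n Phi)|) ^+ 2 +
  \sum_(n in ~: S) (`|inner x (col n Phi)| - `|inner y (col n Phi)|) ^+ 2.
Proof.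
rewrite !sqrtA_pi /inner (bigID (mem S)) /=; congr (_ + _).
  by apply: eq_bigr => n _; rewrite !mxE expr2.
by apply: eq_big => n; rewrite ?inE // => _; rewrite !mxE expr2.
Qed.

Lemma scp_lower_lipschitz s :
    (0 < M)%N -> strong_complement_property Phi s ->
  lower_lipschitz_bound Phi s.
Proof.
move=> M_gt0 scp p q.
rewrite -[p]reprK -[q]reprK; move: (repr p) (repr q) => x y {p q}.
rewrite sign_dist_pi; set d := Num.min _ _.
have d_ge0 : 0 <= d by rewrite le_min !sqrtr_ge0.
have dB : d ^+ 2 <= inner (x - y) (x - y).
  by rewrite -sqr_enorm lerXn2r ?nnegrE ?sqrtr_ge0 // ge_min lexx.
have dD : d ^+ 2 <= inner (x + y) (x + y).
  by rewrite -sqr_enorm lerXn2r ?nnegrE ?sqrtr_ge0 // ge_min lexx orbT.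
(* As [s] may be negative, [s * d] is first bounded by its absolute value; then squares are
   compared. *)
rewrite (le_trans (ler_norm _)) // -sqrtr_sqr; apply: ler_wsqrtr.
pose S := [set n | 0 <= inner x (col n Phi) * inner y (col n Phi)].
rewrite (inner_sqrtA_sub S).
have -> : \sum_(n in S) (`|inner x (col n Phi)| - `|inner y (col n Phi)|) ^+ 2
    = inner (x - y) (gram Phi S *m (x - y)).
  rewrite gram_form; apply: eq_bigr => n; rewrite inE innerDl innerNl => xy_ge0.
  by rewrite !sqrrB !real_normK ?num_real // -normrM ger0_norm.
have -> :
    \sum_(n in ~: S) (`|inner x (col n Phi)| - `|inner y (col n Phi)|) ^+ 2 =
    inner (x + y) (gram Phi (~: S) *m (x + y)).
  rewrite gram_form; apply: eq_bigr => n; rewrite !inE innerDl -ltNge => xy_lt0.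
  rewrite sqrrB sqrrD !real_normK ?num_real // -normrM ltr0_norm //.
  by rewrite mulNrn opprK.
have FB := lambda_min_form M_gt0 (gram_sym S) (x - y).
have FD := lambda_min_form M_gt0 (gram_sym (~: S)) (x + y).
have lB := lambda_min_gram_ge0 Phi S; have lD := lambda_min_gram_ge0 Phi (~: S).
(* One of the two forms is at least [s ^+ 2 * d ^+ 2], and the other is nonnegative. *)
have := scp S; rewrite exprMn le_max => /orP[] s_le; have := sqr_ge0 d; nra.
Qed.

Lemma lower_lipschitz_le a S :
    (0 < M)%N -> lower_lipschitz_bound Phi a -> 0 <= a ->
  a ^+ 2 <= lambda_min (gram Phi S) + lambda_min (gram Phi (~: S)).
Proof.
move=> M_gt0 lip a_ge0.
have [u u1 uS] := lambda_min_attained M_gt0 (gram_sym S).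
have [v v1 vS] := lambda_min_attained M_gt0 (gram_sym (~: S)).
pose x := u + v; pose y := u - v.
have dist2 : sign_dist (\pi x)%qT (\pi y)%qT = 2 :> R.
  rewrite sign_dist_pi.
  have -> : x - y = 2 *: v by rewrite opprB addrC addrA subrK scaler_nat.
  have -> : x + y = 2 *: u by rewrite addrACA subrr addr0 scaler_nat.
  by rewrite !enormZ /enorm u1 v1 sqrtr1 !mulr1 minxx ger0_norm.
have := lip (\pi x)%qT (\pi y)%qT; rewrite dist2.
set w := sqrtA Phi _ - _ => aw.
have : (a * 2) ^+ 2 <= inner w w.
  by rewrite -sqr_enorm lerXn2r ?nnegrE ?sqrtr_ge0 // mulr_ge0.
(* For p = b + c and q = b - c, the absolute values of p and q differ by at most that of p + q =
   2b. *)
have sqr_abs_sub (b c : R) : (`|b + c| - `|b - c|) ^+ 2 <= 4 * b ^+ 2.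
  have := ler_norm (- ((b + c) * (b - c))); rewrite normrN.
  rewrite sqrrB !real_normK ?num_real // -normrM; lra.
rewrite (inner_sqrtA_sub S) => w_le.
have : \sum_(n in S) (`|inner x (col n Phi)| - `|inner y (col n Phi)|) ^+ 2
    <= 4 * lambda_min (gram Phi S).
  rewrite -uS gram_form mulr_sumr ler_sum // => n _.
  by rewrite !innerDl innerNl; exact: sqr_abs_sub.
have :
    \sum_(n in ~: S) (`|inner x (col n Phi)| - `|inner y (col n Phi)|) ^+ 2 <=
    4 * lambda_min (gram Phi (~: S)).
  rewrite -vS gram_form mulr_sumr ler_sum // => n _.
  (* Off [S] the roles of [u] and [v] are exchanged. *)
  rewrite !innerDl innerNl -[inner u _ - _]opprB normrN.
  by rewrite [inner u _ + _]addrC; exact: sqr_abs_sub.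
move: w_le; rewrite exprMn; lra.
Qed.

(** There are finitely many [S], so some [S] minimizes the maximum; the root of the minimal value
    has the property and is thus at most [s]. *)
Lemma scp_largest_sqr s :
  is_largest (strong_complement_property Phi) s ->
  0 <= s /\ exists S, Num.max (lambda_min (gram Phi S))
                             (lambda_min (gram Phi (~: S))) <= s ^+ 2.
Proof.
move=> [scp s_max].
pose F S := Num.max (lambda_min (gram Phi S)) (lambda_min (gram Phi (~: S))).
case: (@arg_minP _ _ _ (finset.set0 : {set 'I_N}) xpredT F isT) => S _ F_min.
have F_ge0 : 0 <= F S by rewrite le_max lambda_min_gram_ge0.
have sqrtF_le : Num.sqrt (F S) <= s.
  by apply: s_max => T; rewrite sqr_sqrtr //; exact: F_min.
have s_ge0 : 0 <= s := le_trans (sqrtr_ge0 _) sqrtF_le.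
split=> //; exists S; rewrite -/(F S) -[F S]sqr_sqrtr //.
by rewrite lerXn2r ?nnegrE ?sqrtr_ge0.
Qed.

End Frame.

(** For [M = 0] all distances vanish, so every real is a bound and none is largest. *)
Lemma lower_lipschitz_largest_gt0 (R : realType) (M N : nat)
    (Phi : 'M[R]_(M, N)) a :
  is_largest (lower_lipschitz_bound Phi) a -> (0 < M)%N.
Proof.
case: M Phi => // Phi [_ a_max].
suff /a_max : lower_lipschitz_bound Phi (a + 1) by rewrite gerDl ler10.
move=> p q; suff -> : sign_dist p q = 0 by rewrite mulr0 sqrtr_ge0.
by rewrite /sign_dist /enorm /inner !big_ord0 sqrtr0 minxx.
Qed.

Unset Implicit Arguments.

Theorem theorem18 (R : realType) (M N : nat) (Phi : 'M[R]_(M, N))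
    (alpha sigma : R)
    (halpha : is_largest (lower_lipschitz_bound Phi) alpha)
    (hsigma : is_largest (strong_complement_property Phi) sigma) :
  sigma <= alpha /\ alpha <= Num.sqrt 2 * sigma.
Proof.
have M_gt0 := lower_lipschitz_largest_gt0 halpha.
have [s_ge0 [S F_le]] := scp_largest_sqr hsigma.
case: halpha hsigma => lip a_max [scp _].
have sa : sigma <= alpha by exact/a_max/scp_lower_lipschitz.
split=> //; have a_ge0 := le_trans s_ge0 sa.
have := lower_lipschitz_le S M_gt0 lip a_ge0.
move: F_le; rewrite ge_max => /andP[FS FSc] a2_le.
(* For the minimizing [S] both eigenvalues are at most [sigma ^+ 2], so their sum gives the factor 2
   after squaring. *)
rewrite -(ler_pXn2r (n := 2)) ?nnegrE ?mulr_ge0 ?sqrtr_ge0 //.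
rewrite exprMn sqr_sqrtr //; lra.
Qed.
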